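(* Let $G$ be a graph with $m\geq 1$ edges. Then $$\psi(G)\leq \frac{2m}{\sqrt{s^+}}\leq \frac{2m}{\mu}\leq 2R(G).$$
   Context: Graphs are finite, simple and undirected, and $d(u)$ denotes the degree of a vertex $u$ in $G$. A complete $k$-coloring of $G$ is a proper vertex coloring of $G$ with $k$ colors such that for each pair of different colors there are adjacent vertices with these colors. The achromatic number $\psi(G)$ is the maximum $k$ for which $G$ has a complete $k$-coloring. Let $\mu=\mu_1\geq\cdots\geq\mu_n$ be the eigenvalues (with multiplicity) of the adjacency matrix of $G$, where $n$ is the number of vertices of $G$, and let $\pi$ be the number of positive eigenvalues (counting multiplicities). Then $s^+=\sum_{i=1}^{\pi}\mu_i^2$ is the sum of the squares of the positive eigenvalues. The Randić index of $G$ is $R(G)=\sum_{uv\in E(G)}\frac{1}{\sqrt{d(u)d(v)}}$. *)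

(* Defs.v *)
From HB Require Import structures.
From mathcomp Require Export all_boot all_order all_algebra.
From mathcomp Require Export polyrcf.

Set Implicit Arguments.
Unset Strict Implicit.
Unset Printing Implicit Defensive.

Import Order.TTheory GRing.Theory Num.Theory.

(* A finite simple graph is a symmetric, irreflexive adjacency relation [e] on
   a finType [T] of vertices; these two hypotheses appear in the theorems. *)

Section Graph.
Variables (T : finType) (e : rel T).

Definition deg (u : T) : nat := #|[set v | e u v]|.

Definition edges : {set {set T}} := [set [set u; v] | u in T, v in T & e u v].

Definition complete_coloring (k : nat) (c : {ffun T -> 'I_k}) : bool :=
  [forall u, forall v, e u v ==> (c u != c v)] &&
  [forall i, forall j, (i != j) ==>
     [exists u, exists v, [&& e u v, c u == i & c v == j]]].

Definition has_complete_coloring (k : nat) : bool :=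
  [exists c : {ffun T -> 'I_k}, complete_coloring c].

(* Restricting to k <= #|T| loses nothing: see [achromatic_number_max]. *)
Definition achromatic_number : nat :=
  \max_(k < #|T|.+1 | has_complete_coloring k) k.

Lemma complete_coloring_card (k : nat) :
  (0 < #|T|)%N -> has_complete_coloring k -> (k <= #|T|)%N.
Proof.
move=> T0 /existsP[c /andP[_ /forallP ccP]].
have [k1|k1] := leqP k 1; first exact: leq_trans k1 T0.
suff cS : forall i, i \in codom c.
  rewrite -[k in (k <= _)%N]card_ord -(size_codom c).
  apply: leq_trans (card_size _); apply: subset_leq_card.
  by apply/subsetP => i _; apply: cS.
move=> i.
have [j ij] : exists j : 'I_k, i != j.
  have k0 := ltnW k1.
  have [->|] := eqVneq i (Ordinal k0); first by exists (Ordinal k1).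
  by exists (Ordinal k0).
have /forallP/(_ j) := ccP i; rewrite ij /= => /existsP[u /existsP[v]].
by case/and3P => _ /eqP <- _; apply: codom_f.
Qed.

Lemma achromatic_number_max (k : nat) :
  (0 < #|T|)%N -> has_complete_coloring k -> (k <= achromatic_number)%N.
Proof.
move=> T0 ck; have := complete_coloring_card T0 ck; rewrite -ltnS => kT.
exact: (@leq_bigmax_cond _ _ (fun k : 'I_#|T|.+1 => k : nat) (Ordinal kT)).
Qed.

End Graph.

Local Open Scope ring_scope.

Section Spectrum.
Variable R : rcfType.

(* The eigenvalues in R of A, in non-increasing order, each repeated according
   to its algebraic multiplicity; when A is symmetric there are n of them. *)
Definition spectrum (n : nat) (A : 'M[R]_n) : seq R :=
  let p := char_poly A in
  sort >=%R (flatten [seq nseq (mup x p) x | x <- rootsR p]).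

Lemma count_mem_spectrum (n : nat) (A : 'M[R]_n) (x : R) :
  count_mem x (spectrum A) = mup x (char_poly A).
Proof.
have p0 : char_poly A != 0 := monic_neq0 (char_poly_monic A).
rewrite /spectrum; set p := char_poly A in p0 *.
rewrite (permP (permEl (perm_sort _ _))) count_flatten -map_comp sumnE big_map.
have [xp|xp] := boolP (x \in rootsR p); last first.
  rewrite big1_seq => [|y /andP[_ yp]] /=; last first.
    by rewrite count_nseq /= (_ : y == x = false) //; apply: contraNF xp => /eqP <-.
  by rewrite mupNroot //; apply: contra xp; rewrite -(roots_on_rootsR p0 x) in_itv.
rewrite (bigD1_seq x) ?uniq_roots //= count_nseq /= eqxx mul1n big1 ?addn0 //.
by move=> y /negPf yx; rewrite count_nseq /= yx.
Qed.

Variables (T : finType) (e : rel T).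

Definition adjacency_matrix : 'M[R]_#|T| :=
  \matrix_(i, j) (e (enum_val i) (enum_val j))%:R.

(* mu_1, the first entry of the non-increasing list of eigenvalues *)
Definition largest_eigenvalue : R := head 0 (spectrum adjacency_matrix).

Definition splus : R := \sum_(x <- spectrum adjacency_matrix | 0 < x) x ^+ 2.

(* The product over the two ends of the edge f = {u, v} is d(u) d(v). *)
Definition randic_index : R :=
  \sum_(f in edges e) 1 / Num.sqrt (\prod_(u in f) (deg e u)%:R).

End Spectrum.

(* Main.v *)
Require Import Defs.
From mathcomp Require Import sesquilinear spectral complex.
From mathcomp Require Import ring lra.

(** Let A be the adjacency matrix, k the number of colors of a complete
    coloring and mu the largest eigenvalue.

    The first inequality is k ^ 2 * s+ <= (2 m) ^ 2, the product of two
    bounds.  Counting edges between color classes gives k (k - 1) <= 2 m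
    ([complete_coloring_edges]).  A proper k-coloring gives the theorem of
    Ando and Lin, k * s+ <= (k - 1) * 2 m ([splus_le_coloring]).  For the
    latter, split A = P - N into positive and negative parts: P and N are Gram
    matrices with P N = 0 and sums of squared entries s+ and s-, whose total is
    tr A^2 = 2 m.  A vanishes inside color classes, so P and N have the same
    diagonal blocks.  Write d for the sum of squares over those blocks, p and q
    for the sums of squares of P and N outside them.  Then tr (P N) = 0 and
    Cauchy-Schwarz give d ^ 2 <= p q, positivity of P gives p + d <= k d, and
    these imply s+ = p + d <= (k - 1) (q + d) = (k - 1) s-
    ([ando_lin_inequality]).

    The second inequality says that mu ^ 2 is one of the terms of s+, mu being
    positive.

    For the third, the Rayleigh quotient of A at the vector with entries
    sqrt (d u) shows that the edge weights w = sqrt (d u * d v) sum to at most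
    mu * m ([sum_sqrt_deg_le]), while Cauchy-Schwarz bounds m ^ 2 by the sum
    of the w times the sum of the 1 / w, which is the Randic index.

    All this rests on orthogonal diagonalization of symmetric matrices over a
    real closed field ([symmetric_spectral]), which also identifies the
    roots of the characteristic polynomial, with multiplicity, with the
    diagonal entries ([spectrum_perm_diag]). *)

Set Implicit Arguments.
Unset Strict Implicit.
Unset Printing Implicit Defensive.
Import Order.TTheory GRing.Theory Num.Theory.
Local Open Scope ring_scope.

(** * Orthogonal diagonalization over a real closed field *)

Lemma char_poly_conj (R : fieldType) n (Q B : 'M[R]_n) :
  Q \in unitmx -> char_poly (invmx Q *m B *m Q) = char_poly B.
Proof.
move=> Qu; rewrite /char_poly /char_poly_mx.
have <- : map_mx polyC (invmx Q) *m ('X%:M - map_mx polyC B) *m map_mx polyC Q =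
    'X%:M - map_mx polyC (invmx Q *m B *m Q).
  rewrite !map_mxM mulmxBr mulmxBl; congr (_ - _).
  by rewrite -mulmxA -scalar_mxC mulmxA -map_mxM mulVmx // map_mx1 mul1mx.
by rewrite !det_mulmx mulrAC -det_mulmx -map_mxM mulVmx // map_mx1 det1 mul1r.
Qed.

Lemma char_poly_diag (R : comNzRingType) n (d : 'rV[R]_n) :
  char_poly (diag_mx d) = \prod_(i < n) ('X - (d 0 i)%:P).
Proof.
rewrite char_poly_trig ?diag_mx_is_trig //.
by apply: eq_bigr => i _; rewrite mxE eqxx mulr1n.
Qed.

(** Over the algebraic closure R[i] the matrix is Hermitian, hence unitarily
    diagonalizable with real diagonal; any diagonal entry will do. *)
Lemma symmetric_eigenvalue (R : rcfType) n (A : 'M[R]_n.+1) :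
  A^T = A -> exists l, eigenvalue A l.
Proof.
move=> symA; pose B := map_mx (real_complex R) A.
have hermB : B \is hermsymmx.
  apply: realsym_hermsym.
    apply/is_hermitianmxP; rewrite expr0 scale1r map_mx_id //.
    by rewrite /B map_trmx symA.
  by apply/mxOverP => i j; rewrite mxE complex_real.
have /orthomx_spectralP specB := hermitian_normalmx hermB.
have /mxOverP/(_ 0 0)/complex_realP[l dl] := hermitian_spectral_diag_real hermB.
exists l; rewrite eigenvalue_root_char -(fmorph_root (real_complex R)).
rewrite map_char_poly -/B specB char_poly_conj ?spectral_unit // char_poly_diag.
by rewrite /= -dl rootE horner_prod big_ord_recl !hornerE subrr mul0r.
Qed.

Lemma row_dot_ge0 (R : realDomainType) n (v : 'rV[R]_n) : 0 <= (v *m v^T) 0 0.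
Proof. by rewrite mxE sumr_ge0 // => i _; rewrite mxE -expr2 sqr_ge0. Qed.

Lemma row_dot_eq0 (R : realDomainType) n (v : 'rV[R]_n) :
  ((v *m v^T) 0 0 == 0) = (v == 0).
Proof.
apply/eqP/eqP => [|->]; last by rewrite mul0mx mxE.
rewrite mxE => /eqP; rewrite psumr_eq0; last first.
  by move=> i _; rewrite mxE -expr2 sqr_ge0.
move=> /allP v0; apply/rowP => i; apply/eqP; rewrite mxE -sqrf_eq0 expr2.
by have := v0 i; rewrite mem_index_enum mxE; apply.
Qed.

(** The reflection exchanging u and v; it lets the induction of the spectral
    theorem move a unit eigenvector to the first coordinate axis. *)
Lemma householder (R : realFieldType) n (u v : 'rV[R]_n) :
  u *m u^T = 1%:M -> v *m v^T = 1%:M ->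
  exists H : 'M[R]_n, [/\ H^T = H, H *m H = 1%:M & u *m H = v].
Proof.
move=> uu vv; have [->|uv] := eqVneq u v.
  by exists 1%:M; rewrite trmx1 !mulmx1.
pose w := u - v; pose t := (w *m w^T) 0 0.
have t0 : t != 0 by rewrite row_dot_eq0 subr_eq0.
have ww : w *m w^T = t%:M by apply: mx11_scalar.
have vu : v *m u^T = u *m v^T
  by apply: trmx_inj; rewrite trmx_mul trmxK [u *m _]mx11_scalar tr_scalar_mx.
(* For unit vectors u and v, |u - v|^2 = 2 u . (u - v). *)
have uw : 2%:R *: (u *m w^T) = t%:M.
  rewrite -ww /w linearB /= mulmxBr mulmxBl !mulmxBr uu vv vu.
  by rewrite scaler_nat mulr2n opprB.
exists (1%:M - (2%:R / t) *: (w^T *m w)); split.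
- by rewrite linearB linearZ /= trmx1 trmx_mul trmxK.
- have MM : w^T *m w *m (w^T *m w) = t *: (w^T *m w).
    by rewrite mulmxA -(mulmxA w^T) ww mul_mx_scalar scalemxAl.
  move: (w^T *m w) MM => M MM.
  rewrite mulmxBl !mulmxBr !mul1mx mulmx1 -scalemxAl -scalemxAr MM.
  by apply/matrixP => i j; rewrite !mxE; field.
- rewrite mulmxBr mulmx1 -scalemxAr mulmxA [2 / t]mulrC -scalerA scalemxAl uw.
  by rewrite mul_scalar_mx scalerA mulVf // scale1r /w opprB addrC addrNK.
Qed.

(** Conjugating by a reflection that sends a unit eigenvector to the first axis
    leaves, by symmetry, a block diagonal matrix, to which induction
    applies. *)
Theorem symmetric_spectral (R : rcfType) n (A : 'M[R]_n) : A^T = A ->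
  exists (Q : 'M[R]_n) (d : 'rV[R]_n),
    Q *m Q^T = 1%:M /\ A = Q^T *m diag_mx d *m Q.
Proof.
elim: n A => [|n IHn] A symA.
  by exists 1%:M, 0; split; apply/matrixP => -[].
have [l /eigenvalueP[x xA x0]] := symmetric_eigenvalue symA.
have := row_dot_ge0 x; have := x0; rewrite -row_dot_eq0.
move: (mx11_scalar (x *m x^T)); move: (_ 0 0) => c xx c0 c_ge0.
pose v := (Num.sqrt c)^-1 *: x.
have vv : v *m v^T = 1%:M.
  rewrite /v linearZ /= -scalemxAl -scalemxAr scalerA xx.
  by rewrite scale_scalar_mx -expr2 exprVn sqr_sqrtr ?mulVf.
have vA : v *m A = l *: v by rewrite /v -scalemxAl xA !scalerA mulrC.
pose e0 : 'rV[R]_(1 + n) := row_mx 1%:M 0.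
have ee : e0 *m e0^T = 1%:M.
  by rewrite /e0 tr_row_mx mul_row_col trmx1 mulmx1 mul0mx addr0.
have [H [symH HH eH]] := householder ee vv.
have vH : v *m H = e0 by rewrite -eH -mulmxA HH mulmx1.
pose B : 'M[R]_(1 + n) := H *m A *m H.
have symB : B^T = B by rewrite /B !trmx_mul symH symA mulmxA.
have eB : e0 *m B = l *: e0 by rewrite /B !mulmxA eH vA -scalemxAl vH.
have AB : A = H *m B *m H by rewrite /B !mulmxA HH mul1mx -mulmxA HH mulmx1.
have [ul ur] : ulsubmx B = l%:M /\ ursubmx B = 0.
  move: eB; rewrite -[B in e0 *m B]submxK /e0 mul_row_block !mul1mx !mul0mx !addr0.
  by rewrite scale_row_mx scaler0 scalemx1 => /eq_row_mx.
have dl : dlsubmx B = 0 by rewrite -[LHS]trmxK trmx_dlsub symB ur trmx0.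
have symC : (drsubmx B)^T = drsubmx B by rewrite trmx_drsub symB.
have [Q [d [QQ Cd]]] := IHn _ symC.
pose Q1 : 'M[R]_(1 + n) := block_mx 1%:M 0 0 Q.
have QQ1 : Q1 *m Q1^T = 1%:M.
  rewrite /Q1 tr_block_mx mulmx_block !trmx0 trmx1 !mulmx0 !mul0mx mulmx1.
  by rewrite !addr0 add0r QQ -scalar_mx_block.
have BE : B = Q1^T *m diag_mx (row_mx l%:M d) *m Q1.
  rewrite -[LHS]submxK ul ur dl Cd /Q1 tr_block_mx diag_mx_row !mulmx_block.
  rewrite !trmx0 !mulmx0 !mul0mx !addr0 !add0r trmx1 mul1mx mulmx1.
  congr block_mx; rewrite ?mul0mx //.
  by apply/matrixP => i j; rewrite !ord1 !mxE.
exists (Q1 *m H), (row_mx l%:M d); split.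
  by rewrite trmx_mul symH mulmxA -(mulmxA Q1) HH mulmx1.
by rewrite AB BE trmx_mul symH !mulmxA.
Qed.

(** * Consequences for the spectrum *)

Lemma spectrum_perm_diag (R : rcfType) n (A Q : 'M[R]_n) (d : 'rV[R]_n) :
  Q *m Q^T = 1%:M -> A = Q^T *m diag_mx d *m Q ->
  perm_eq (spectrum A) [seq d 0 i | i <- enum 'I_n].
Proof.
move=> QQ AE; have [Qu _] := mulmx1_unit QQ.
have QV : invmx Q = Q^T by rewrite -[LHS]mulmx1 -QQ mulKmx.
apply/allP => x _ /=; apply/eqP; rewrite count_mem_spectrum AE -QV.
rewrite char_poly_conj // char_poly_diag -mu_prod_XsubC big_map.
by rewrite big_enum.
Qed.

Lemma le_head_spectrum (R : rcfType) n (A : 'M[R]_n) (x : R) :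
  x \in spectrum A -> x <= head 0 (spectrum A).
Proof.
rewrite /spectrum; set s := sort _ _.
have : sorted >=%R s by apply: sort_sorted => y z; rewrite orbC le_total.
case: s => //= y s ys; rewrite inE => /predU1P[->//|xs].
have /allP/(_ x xs) // : all (>=%R y) s.
by apply: order_path_min ys => a b c ab /le_trans; apply.
Qed.

Lemma rayleigh_le (R : rcfType) n (A : 'M[R]_n) (x : 'rV[R]_n) : A^T = A ->
  (x *m A *m x^T) 0 0 <= head 0 (spectrum A) * (x *m x^T) 0 0.
Proof.
move=> /symmetric_spectral[Q [d [QQ AE]]].
have dA i : d 0 i <= head 0 (spectrum A).
  apply: le_head_spectrum; rewrite (perm_mem (spectrum_perm_diag QQ AE)).
  by rewrite map_f // mem_enum.
have xx : x *m x^T = (x *m Q^T) *m (x *m Q^T)^T.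
  by rewrite trmx_mul trmxK mulmxA -(mulmxA x) (mulmx1C QQ) mulmx1.
have xAx : x *m A *m x^T = (x *m Q^T) *m diag_mx d *m (x *m Q^T)^T.
  by rewrite trmx_mul trmxK AE !mulmxA.
rewrite {}xx {}xAx; move: (x *m Q^T) => y.
rewrite mxE [X in _ <= _ * X]mxE mulr_sumr; apply: ler_sum => i _.
rewrite mul_mx_diag !mxE mulrAC [_ * d _ _]mulrC.
by rewrite ler_wpM2r // -expr2 sqr_ge0.
Qed.

Lemma trace_mul_tr (R : comNzRingType) m n (M : 'M[R]_(m, n)) :
  \tr (M *m M^T) = \sum_i \sum_j M i j ^+ 2.
Proof.
by apply: eq_bigr => i _; rewrite mxE; apply: eq_bigr => j _; rewrite mxE expr2.
Qed.

(** The positive and negative parts are given by Gram factors B and C, because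
    the pinching inequality needs the factor; B C^T = 0 is the orthogonality
    of the ranges of the two parts. *)
Lemma symmetric_pos_neg_parts (R : rcfType) n (A : 'M[R]_n) : A^T = A ->
  exists B C : 'M[R]_n,
    [/\ A = B^T *m B - C^T *m C, B *m C^T = 0
      & \sum_i \sum_j (B^T *m B) i j ^+ 2
        = \sum_(x <- spectrum A | 0 < x) x ^+ 2].
Proof.
move=> /symmetric_spectral[Q [d [QQ AE]]].
(* [Num.sqrt] is 0 on negative numbers, so s = 1 and s = - 1 select the
   positive and the negative eigenvalues. *)
pose root (s : R) : 'rV[R]_n := \row_i Num.sqrt (s * d 0 i).
pose F s := diag_mx (root s) *m Q.
have FT s : (F s)^T = Q^T *m diag_mx (root s) by rewrite trmx_mul tr_diag_mx.
exists (F 1), (F (- 1)); split.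
- rewrite !FT /F !mulmxA -!(mulmxA Q^T) -mulmxBr -mulmxBl mulmxA AE.
  congr (_ *m _ *m _); rewrite !mulmx_diag -linearB /=; congr diag_mx.
  apply/rowP => i; rewrite !mxE -!expr2 mul1r mulN1r.
  have [d0|d0] := leP 0 (d 0 i).
    by rewrite sqr_sqrtr // [Num.sqrt (- _)]ler0_sqrtr ?oppr_le0 // expr0n subr0.
  by rewrite ltr0_sqrtr // sqr_sqrtr ?oppr_ge0 ?ltW // expr0n sub0r opprK.
- rewrite FT /F mulmxA -(mulmxA (diag_mx _)) QQ mulmx1 mulmx_diag.
  rewrite -[RHS](raddf0 (@diag_mx R n)); congr diag_mx; apply/rowP => i.
  rewrite !mxE mul1r mulN1r; have [d0|/ltW d0] := leP 0 (d 0 i).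
    by rewrite [Num.sqrt (- _)]ler0_sqrtr ?oppr_le0 ?mulr0.
  by rewrite ler0_sqrtr // mul0r.
rewrite -trace_mul_tr [(_ *m F 1)^T]trmx_mul trmxK FT /F.
rewrite !mulmxA -!(mulmxA _ Q Q^T) QQ !mulmx1 mxtrace_mulC !mulmxA QQ.
rewrite mul1mx !mulmx_diag mxtrace_diag.
rewrite (perm_big _ (spectrum_perm_diag QQ AE)) big_map /= big_enum_cond /=.
rewrite [RHS]big_mkcond /=; apply: eq_bigr => i _; rewrite !mxE mul1r.
have [d0|d0] := ltP 0 (d 0 i); last by rewrite ler0_sqrtr ?mulr0.
by rewrite -[in RHS](sqr_sqrtr (ltW d0)); ring.
Qed.

(** * The inequality of Ando and Lin *)

Lemma sum_cauchy_schwarz (R : realFieldType) (I : finType) (S : pred I)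
    (f g : I -> R) :
  (\sum_(i | S i) f i * g i) ^+ 2
    <= (\sum_(i | S i) f i ^+ 2) * (\sum_(i | S i) g i ^+ 2).
Proof.
have : 0 <= \sum_(i | S i) \sum_(j | S j) (f i * g j - f j * g i) ^+ 2.
  by apply: sumr_ge0 => i _; apply: sumr_ge0 => j _; apply: sqr_ge0.
set F := \sum_(i | S i) f i ^+ 2; set G := \sum_(i | S i) g i ^+ 2.
set H := \sum_(i | S i) f i * g i.
have -> : \sum_(i | S i) \sum_(j | S j) (f i * g j - f j * g i) ^+ 2
    = F * G + G * F - 2 * (H * H).
  rewrite !big_distrlr /= mulr_sumr -big_split -sumrB /=; apply: eq_bigr => i _.
  rewrite mulr_sumr -big_split -sumrB /=; apply: eq_bigr => j _; ring.
by rewrite expr2; nra.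
Qed.

(** The Gram matrices F F^T and F^T F have the same sum of squared entries; the
    right-hand side is additive in S before squaring, which is what makes
    color classes tractable. *)
Lemma gram_sum_sq (R : comNzRingType) (I J : finType) (S : pred I)
    (f : I -> J -> R) :
  \sum_(i | S i) \sum_(j | S j) (\sum_a f i a * f j a) ^+ 2
    = \sum_a \sum_b (\sum_(i | S i) f i a * f i b) ^+ 2.
Proof.
transitivity (\sum_(i | S i) \sum_(j | S j) \sum_a \sum_b
    (f i a * f i b) * (f j a * f j b)).
  apply: eq_bigr => i _; apply: eq_bigr => j _; rewrite expr2 big_distrlr /=.
  by apply: eq_bigr => a _; apply: eq_bigr => b _; ring.
under eq_bigr => i _ do rewrite exchange_big /=.
rewrite exchange_big; apply: eq_bigr => a _ /=.
under eq_bigr => i _ do rewrite exchange_big /=.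
rewrite exchange_big; apply: eq_bigr => b _ /=.
by rewrite expr2 big_distrlr.
Qed.

(** Through [gram_sum_sq], both sides become sums over (a, b) and the claim
    reduces to (sum of the y_l)^2 <= #|L| * sum of the y_l^2, where y_l is the
    contribution of the class l. *)
Lemma gram_pinching (R : realFieldType) (I J L : finType) (c : I -> L)
    (f : I -> J -> R) :
  \sum_i \sum_j (\sum_a f i a * f j a) ^+ 2
    <= #|L|%:R * \sum_(x : I * I | c x.1 == c x.2)
                    (\sum_a f x.1 a * f x.2 a) ^+ 2.
Proof.
have -> : \sum_(x : I * I | c x.1 == c x.2) (\sum_a f x.1 a * f x.2 a) ^+ 2
    = \sum_l \sum_a \sum_b (\sum_(i | c i == l) f i a * f i b) ^+ 2.
  under [RHS]eq_bigr => l _ do rewrite -gram_sum_sq pair_big_dep /=.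
  rewrite (partition_big (fun x => c x.1) predT) //=; apply: eq_bigr => l _.
  by apply: eq_bigl => x; rewrite andbC; case: eqP => //= ->; rewrite eq_sym.
rewrite (gram_sum_sq predT) [X in _ <= _ * X]exchange_big mulr_sumr.
apply: ler_sum => a _; rewrite [X in _ <= _ * X]exchange_big mulr_sumr.
apply: ler_sum => b _.
rewrite (partition_big c predT) //=.
have := sum_cauchy_schwarz predT (fun=> 1)
  (fun l => \sum_(i | c i == l) f i a * f i b).
by rewrite -mulr_sumr mul1r expr1n sumr_const.
Qed.

(** The Gram matrices of B and C stand for the positive and negative parts of a
    matrix vanishing on the color classes.  With d the common diagonal block
    part and p, q the off-diagonal parts: d^2 <= p q, because the trace of the
    product is 0, and p <= k d by pinching into k + 1 classes; hence
    p (p + d) <= k p d + k d^2 <= p * k (d + q). *)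
Lemma ando_lin_inequality (R : realFieldType) n k (c : 'I_n -> 'I_k.+1)
    (B C : 'M[R]_n) :
  B *m C^T = 0 ->
  (forall i j, c i = c j -> (B^T *m B - C^T *m C) i j = 0) ->
  \sum_i \sum_j (B^T *m B) i j ^+ 2
    <= k%:R * \sum_i \sum_j (C^T *m C) i j ^+ 2.
Proof.
move=> BC AC; set P := B^T *m B; set N := C^T *m C.
have PN i j : c i = c j -> P i j = N i j.
  by move=> /AC /eqP; rewrite !mxE subr_eq0 => /eqP.
have trPN : \sum_(x : 'I_n * 'I_n) P x.1 x.2 * N x.1 x.2 = 0.
  transitivity (\tr (P *m N^T)).
    rewrite -(pair_bigA _ (fun i j => P i j * N i j)) /=.
    apply: eq_bigr => i _; rewrite [RHS]mxE; apply: eq_bigr => j _.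
    by rewrite [N^T _ _]mxE.
  by rewrite trmx_mul trmxK mulmxA -(mulmxA B^T) BC mulmx0 mul0mx mxtrace0.
pose same (x : 'I_n * 'I_n) := c x.1 == c x.2.
pose d := \sum_(x | same x) P x.1 x.2 ^+ 2.
pose p := \sum_(x | ~~ same x) P x.1 x.2 ^+ 2.
pose q := \sum_(x | ~~ same x) N x.1 x.2 ^+ 2.
have dN : d = \sum_(x | same x) N x.1 x.2 ^+ 2.
  by apply: eq_bigr => x /eqP/PN ->.
have split_sum (M : 'M[R]_n) : \sum_i \sum_j M i j ^+ 2 =
    \sum_(x | same x) M x.1 x.2 ^+ 2 + \sum_(x | ~~ same x) M x.1 x.2 ^+ 2.
  by rewrite pair_bigA (bigID same).
rewrite !split_sum -dN -/d -/p -/q.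
have d_ge0 : 0 <= d by apply: sumr_ge0 => x _; apply: sqr_ge0.
have p_ge0 : 0 <= p by apply: sumr_ge0 => x _; apply: sqr_ge0.
have q_ge0 : 0 <= q by apply: sumr_ge0 => x _; apply: sqr_ge0.
have dd : d ^+ 2 <= p * q.
  have -> : d = - \sum_(x | ~~ same x) P x.1 x.2 * N x.1 x.2.
    apply/eqP; rewrite -addr_eq0 -[X in _ == X]trPN [X in _ == X](bigID same) /=.
    apply/eqP; congr (_ + _).
    by apply: eq_bigr => x /eqP/PN ->; rewrite expr2.
  by rewrite sqrrN; apply: sum_cauchy_schwarz.
have pd : p + d <= k.+1%:R * d.
  have := gram_pinching c (fun i a => B a i); rewrite card_ord.
  have PE i j : \sum_a B a i * B a j = P i j.
    by rewrite mxE; apply: eq_bigr => a _; rewrite mxE.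
  under eq_bigr => i _ do under eq_bigr => j _ do rewrite PE.
  under [X in _ <= _ * X]eq_bigr => x _ do rewrite PE.
  by rewrite split_sum addrC.
have {pd}pk : p <= k%:R * d by rewrite -natr1 mulrDl mul1r lerD2r in pd.
have k_ge0 : 0 <= k%:R :> R by [].
have [p0|p0] := eqVneq p 0.
  have d0 : d = 0 by apply/eqP; rewrite -sqrf_eq0 eq_le sqr_ge0 -(mul0r q) -p0 dd.
  by rewrite p0 d0 !addr0 add0r mulr_ge0.
have p_gt0 : 0 < p by rewrite lt0r p0.
rewrite -(ler_pM2l p_gt0).
have h1 := ler_wpM2l p_ge0 pk; have h2 := ler_wpM2r d_ge0 pk.
have h3 := ler_wpM2l k_ge0 dd.
nra.
Qed.

(** * Sums over the edges of a graph *)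

Lemma sum_enum_val (R : nmodType) (T : finType) (F : T -> R) :
  \sum_(i < #|T|) F (enum_val i) = \sum_(u : T) F u.
Proof. by rewrite -big_enum_val. Qed.

Lemma sum_adjacency_matrix (R : rcfType) (T : finType) (e : rel T)
    (F : T -> T -> R) :
  \sum_i \sum_j adjacency_matrix R e i j * F (enum_val i) (enum_val j)
    = \sum_(x : T * T | e x.1 x.2) F x.1 x.2.
Proof.
under eq_bigr => i _ do under eq_bigr => j _ do rewrite mxE.
under eq_bigr => i _ do
  rewrite (sum_enum_val (fun v => (e (enum_val i) v)%:R * F (enum_val i) v)).
rewrite (sum_enum_val (fun u => \sum_v (e u v)%:R * F u v)) pair_bigA /=.
rewrite [RHS]big_mkcond /=; apply: eq_bigr => x _.
by case: e; rewrite ?mul1r ?mul0r.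
Qed.

(** Every edge {u, v} is reached by exactly the two arcs (u, v) and (v, u). *)
Lemma sum_arcs (R : pzSemiRingType) (T : finType) (e : rel T)
    (F : {set T} -> R) : symmetric e -> irreflexive e ->
  \sum_(x : T * T | e x.1 x.2) F [set x.1; x.2] = 2 * \sum_(f in edges e) F f.
Proof.
move=> e_sym e_irr.
rewrite (partition_big (fun x : T * T => [set x.1; x.2]) (mem (edges e))) /=.
  rewrite mulr_sumr; apply: eq_bigr => f /imset2P[u v _]; rewrite inE /= => uv ->.
  have u_neq_v : u != v by apply: contraTneq uv => ->; rewrite e_irr.
  rewrite (eq_bigr (fun=> F [set u; v])) => [|x /andP[_ /eqP->] //].
  rewrite (bigD1 (u, v)) /= ?uv ?eqxx // (bigD1 (v, u)) /=; last first.
    by rewrite e_sym uv setUC eqxx /= xpair_eqE negb_and eq_sym u_neq_v.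
  rewrite big1 ?addr0 ?mulrDl ?mul1r // => -[a b] /=.
  rewrite !xpair_eqE => /andP[/andP[/andP[ab /eqP E] nuv] nvu].
  have := set21 a b; have := set22 a b; rewrite E !inE.
  by case/orP=> /eqP bE /orP[]/eqP aE; rewrite aE bE ?eqxx ?e_irr // in ab nuv nvu.
by move=> [u v] /= uv; apply/imset2P; exists u v; rewrite ?inE.
Qed.

Lemma sum_deg (R : pzSemiRingType) (T : finType) (e : rel T) :
  symmetric e -> irreflexive e -> \sum_u (deg e u)%:R = 2 * #|edges e|%:R :> R.
Proof.
move=> e_sym e_irr; rewrite -sumr_const -(sum_arcs (fun=> 1)) //.
rewrite -(pair_big_dep predT e (fun _ _ => 1)) /=; apply: eq_bigr => u _.
by rewrite sumr_const; congr (_ *+ _); apply: eq_card => v; rewrite inE.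
Qed.

Lemma prod_edge (R : comPzRingType) (T : finType) (e : rel T) (F : T -> R) u v :
  irreflexive e -> e u v -> \prod_(w in [set u; v]) F w = F u * F v.
Proof.
move=> e_irr uv; rewrite big_setU1 ?big_set1 // inE.
by apply: contraTneq uv => ->; rewrite e_irr.
Qed.

Lemma adjacency_matrix_sym (R : rcfType) (T : finType) (e : rel T) :
  symmetric e -> (adjacency_matrix R e)^T = adjacency_matrix R e.
Proof. by move=> e_sym; apply/matrixP => i j; rewrite !mxE e_sym. Qed.

(** * The largest eigenvalue and the Randic index *)

(** Rayleigh quotient at the vector with entries sqrt (deg u), whose squared
    norm is the sum of the degrees. *)
Lemma sum_sqrt_deg_le (R : rcfType) (T : finType) (e : rel T) :
  symmetric e -> irreflexive e ->
  \sum_(f in edges e) Num.sqrt (\prod_(u in f) (deg e u)%:R)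
    <= largest_eigenvalue R e * #|edges e|%:R.
Proof.
move=> e_sym e_irr.
have := rayleigh_le (\row_i Num.sqrt (deg e (enum_val i))%:R)
  (adjacency_matrix_sym R e_sym).
set x := \row_i _; rewrite -/(largest_eigenvalue R e).
have -> : (x *m x^T) 0 0 = 2 * #|edges e|%:R.
  rewrite mxE -sum_deg // -(sum_enum_val (fun u => (deg e u)%:R)).
  apply: eq_bigr => i _.
  by rewrite !mxE -expr2 sqr_sqrtr.
have -> : (x *m adjacency_matrix R e *m x^T) 0 0
    = 2 * \sum_(f in edges e) Num.sqrt (\prod_(u in f) (deg e u)%:R).
  rewrite -sum_arcs // [RHS](eq_bigr (fun y =>
    Num.sqrt (deg e y.1)%:R * Num.sqrt (deg e y.2)%:R)); last first.
    by move=> y ey; rewrite (prod_edge _ e_irr ey) sqrtrM.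
  rewrite -(sum_adjacency_matrix e (fun u v =>
    Num.sqrt (deg e u)%:R * Num.sqrt (deg e v)%:R)).
  rewrite exchange_big mxE; apply: eq_bigr => j _.
  rewrite [(x *m _) _ _]mxE mulr_suml; apply: eq_bigr => i _.
  by rewrite !mxE; ring.
by rewrite mulrCA ler_pM2l.
Qed.

Lemma edge_weight_gt0 (R : rcfType) (T : finType) (e : rel T) (f : {set T}) :
  symmetric e -> f \in edges e ->
  0 < Num.sqrt (\prod_(u in f) (deg e u)%:R) :> R.
Proof.
move=> e_sym /imset2P[u v _]; rewrite inE /= => uv ->.
rewrite sqrtr_gt0; apply: prodr_gt0 => w; rewrite ltr0n card_gt0.
by case/set2P => ->; apply/set0Pn; [exists v | exists u]; rewrite inE // e_sym.
Qed.

(** The previous bound forces positivity, as its left-hand side is positive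
    once there is an edge. *)
Lemma largest_eigenvalue_gt0 (R : rcfType) (T : finType) (e : rel T) :
  symmetric e -> irreflexive e -> (0 < #|edges e|)%N ->
  0 < largest_eigenvalue R e.
Proof.
move=> e_sym e_irr m_gt0.
have m_gt0R : 0 < #|edges e|%:R :> R by rewrite ltr0n.
rewrite -(pmulr_lgt0 _ m_gt0R); apply: lt_le_trans (sum_sqrt_deg_le R e_sym e_irr).
have /set0Pn[f fe] : edges e != set0 by rewrite -card_gt0.
rewrite (bigD1 f) //= ltr_pwDl ?edge_weight_gt0 // sumr_ge0 // => g _.
exact: sqrtr_ge0.
Qed.

(** Cauchy-Schwarz on the edges for sqrt w and 1 / sqrt w, where w is the square
    root of the product of the degrees of the two ends. *)
Lemma edges_le_eigenvalue_randic (R : rcfType) (T : finType) (e : rel T) :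
  symmetric e -> irreflexive e ->
  (0 < #|edges e|)%N ->
  #|edges e|%:R <= largest_eigenvalue R e * randic_index R e.
Proof.
move=> e_sym e_irr m_gt0; rewrite /randic_index.
have m_gt0R : 0 < #|edges e|%:R :> R by rewrite ltr0n.
pose w (f : {set T}) : R := Num.sqrt (\prod_(u in f) (deg e u)%:R).
have w_gt0 f : f \in edges e -> 0 < w f by apply: edge_weight_gt0.
have := sum_cauchy_schwarz (mem (edges e))
  (fun f => Num.sqrt (w f)) (fun f => (Num.sqrt (w f))^-1).
have -> : \sum_(f in edges e) Num.sqrt (w f) / Num.sqrt (w f) = #|edges e|%:R.
  rewrite (eq_bigr (fun=> 1)) ?sumr_const // => f /w_gt0 wf.
  by rewrite divff // sqrtr_eq0 -ltNge.
rewrite [X in X * _](eq_bigr w) => [|f /w_gt0/ltW]; last exact: sqr_sqrtr.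
rewrite [X in _ * X](eq_bigr (fun f => 1 / w f)) => [|f /w_gt0/ltW wf]; last first.
  by rewrite exprVn sqr_sqrtr // div1r.
move=> CS; rewrite -(ler_pM2r m_gt0R) -expr2; apply: le_trans CS _.
rewrite mulrAC ler_wpM2r ?sum_sqrt_deg_le //.
by apply: sumr_ge0 => f /w_gt0 wf; rewrite divr_ge0 // ltW.
Qed.

Lemma sqr_largest_le_splus (R : rcfType) (T : finType) (e : rel T) :
  0 < largest_eigenvalue R e -> largest_eigenvalue R e ^+ 2 <= splus R e.
Proof.
rewrite /largest_eigenvalue /splus; case: spectrum => /= [|x s x_gt0].
  by rewrite ltxx.
by rewrite big_cons x_gt0 lerDl sumr_ge0 // => y _; apply: sqr_ge0.
Qed.

(** * The achromatic number *)

(** The coloring maps the 2 m arcs onto a set containing all k (k - 1) ordered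
    pairs of distinct colors. *)
Lemma complete_coloring_edges (T : finType) (e : rel T) k
    (c : {ffun T -> 'I_k}) : symmetric e -> irreflexive e ->
  complete_coloring e c -> (k * k.-1 <= 2 * #|edges e|)%N.
Proof.
move=> e_sym e_irr /andP[_ /forallP cP].
have -> : (2 * #|edges e|)%N = #|[set x : T * T | e x.1 x.2]|.
  have := @sum_arcs int _ _ (fun=> 1) e_sym e_irr.
  by rewrite !sumr_const => /eqP; rewrite -natrM eqr_nat cardsE => /eqP.
have <- : #|[set y : 'I_k * 'I_k | y.1 != y.2]| = (k * k.-1)%N.
  transitivity (\sum_(i < k) \sum_(j < k | i != j) 1)%N.
    by rewrite pair_big_dep /= sum1dep_card.
  rewrite (eq_bigr (fun=> k.-1)) ?sum_nat_const ?card_ord // => i _.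
  rewrite sum1dep_card -[k in RHS]card_ord -(cardC1 i).
  by apply: eq_card => j; rewrite !inE eq_sym.
apply: leq_trans (leq_imset_card (fun x => (c x.1, c x.2)) _).
apply/subset_leq_card/subsetP => -[i j]; rewrite inE /= => ij.
have /forallP/(_ j) := cP i; rewrite ij => /existsP[u /existsP[v]].
by case/and3P => uv /eqP <- /eqP <-; apply/imsetP; exists (u, v); rewrite ?inE.
Qed.

(** The factor k on the left, instead of a division by k, also covers the empty
    graph, where k may be 0. *)
Lemma splus_le_coloring (R : rcfType) (T : finType) (e : rel T) k
    (c : T -> 'I_k) : symmetric e -> irreflexive e ->
  (forall u v, e u v -> c u != c v) ->
  k%:R * splus R e <= k.-1%:R * (2 * #|edges e|%:R).
Proof.
case: k c => [|k] c e_sym e_irr cP; first by rewrite !mul0r.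
have symA := adjacency_matrix_sym R e_sym.
have [B [C [AE BC sE]]] := symmetric_pos_neg_parts symA.
rewrite -/(splus R e) in sE.
have Ac i j : c (enum_val i) = c (enum_val j) -> (B^T *m B - C^T *m C) i j = 0.
  move=> cij; rewrite -AE mxE; case eij: (e _ _) => //.
  by have := cP _ _ eij; rewrite cij eqxx.
have := ando_lin_inequality (c := (fun i => c (enum_val i))) BC Ac; rewrite sE.
set P := B^T *m B; set N := C^T *m C; set sN := \sum_i _.
have sumA : \sum_i \sum_j adjacency_matrix R e i j ^+ 2 = 2 * #|edges e|%:R.
  rewrite -sumr_const -(sum_arcs (fun=> 1)) //.
  rewrite -(sum_adjacency_matrix e (fun _ _ => 1)).
  apply: eq_bigr => i _; apply: eq_bigr => j _; rewrite mxE.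
  by case: (e _ _); rewrite mulr1 ?expr1n ?expr0n.
have : \sum_i \sum_j adjacency_matrix R e i j ^+ 2 = splus R e + sN.
  rewrite -sE /sN -!trace_mul_tr symA AE -/P -/N.
  have PN : P *m N = 0 by rewrite /P /N mulmxA -(mulmxA B^T) BC mulmx0 mul0mx.
  have NP : N *m P = 0.
    have CB : C *m B^T = 0 by rewrite -[LHS]trmxK trmx_mul trmxK BC trmx0.
    by rewrite /P /N mulmxA -(mulmxA C^T) CB mulmx0 mul0mx.
  have PT : P^T = P by rewrite trmx_mul trmxK.
  have NT : N^T = N by rewrite trmx_mul trmxK.
  rewrite mulmxBl !mulmxBr PN NP subr0 sub0r opprK raddfD /=.
  by rewrite PT NT.
rewrite sumA => ->; rewrite /= -natr1; nra.
Qed.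

Theorem theorem3p1 (R : rcfType) (T : finType) (e : rel T)
    (e_sym : symmetric e) (e_irr : irreflexive e)
    (m : nat) (m_edges : m = #|edges e|) (m_ge1 : (1 <= m)%N) :
  [/\ (achromatic_number e)%:R <= 2 * m%:R / Num.sqrt (splus R e),
      2 * m%:R / Num.sqrt (splus R e) <= 2 * m%:R / largest_eigenvalue R e
    & 2 * m%:R / largest_eigenvalue R e <= 2 * randic_index R e].
Proof.
subst m; have mu_gt0 := largest_eigenvalue_gt0 R e_sym e_irr m_ge1.
have mu_le := sqr_largest_le_splus mu_gt0.
have s_gt0 : 0 < splus R e by apply: lt_le_trans mu_le; rewrite exprn_gt0.
have rs_gt0 : 0 < Num.sqrt (splus R e) by rewrite sqrtr_gt0.
have m_ge0 : 0 <= 2 * #|edges e|%:R :> R by rewrite mulr_ge0.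
split.
(* The bound is inherited by maxima, so it suffices to treat one coloring. *)
- rewrite /achromatic_number; elim/big_ind: _ => [|x y xP yP|k /existsP[c cc]].
  + by rewrite divr_ge0 // ltW.
  + by rewrite /maxn; case: ifP.
  rewrite ler_pdivlMr // -(ler_pXn2r (n := 2)) // ?nnegrE ?mulr_ge0 ?(ltW rs_gt0) //.
  rewrite exprMn (sqr_sqrtr (ltW s_gt0)) [k%:R ^+ 2]expr2 -mulrA.
  have properc u v : e u v -> c u != c v.
    by case/andP: (cc) => /forallP/(_ u)/forallP/(_ v)/implyP.
  apply: le_trans (ler_wpM2l _ (splus_le_coloring R e_sym e_irr properc)) _ => //.
  rewrite [leLHS]mulrA expr2 ler_wpM2r // -!natrM ler_nat.
  exact: complete_coloring_edges cc.
- rewrite ler_wpM2l // lef_pV2 ?posrE // -(ler_pXn2r (n := 2)) //;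
    rewrite ?nnegrE ?(ltW mu_gt0) ?(ltW rs_gt0) //.
  by rewrite (sqr_sqrtr (ltW s_gt0)).
- rewrite -mulrA ler_pM2l // ler_pdivrMr // mulrC.
  exact: edges_le_eigenvalue_randic.
Qed.
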